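(* Let $L/K$ be a finite separable field extension of degree $[L:K]=2^e$ with $e\geq 1$, admitting a Hopf--Galois structure of cyclic type, and let $G$ be the Galois group of the normal closure $\widetilde{L}$ of $L/K$ over $K$. Then $|G|=2^s[L:K]$ for some integer $s\geq 0$ (so $|G|$ is a power of $2$), and: (1) if $s=1$ and $G$ has an element of order $[L:K]$, then every extension $L'/K$ parallel to $L/K$ admits a Hopf--Galois structure of cyclic type; (2) if $s=1$ and $G$ has no element of order $[L:K]$, or if $s\geq 2$, then there exists a normal extension $L'/K$ parallel to $L/K$ that does not admit a Hopf--Galois structure of cyclic type.
   Context: For a finite separable extension $L/K$ with normal closure $\widetilde{L}$, put $G=\mathrm{Gal}(\widetilde{L}/K)$ and $G'=\mathrm{Gal}(\widetilde{L}/L)$, and let $\lambda:G\to\mathrm{Sym}(G/G')$, $\lambda(g)(hG')=ghG'$. By Greither--Pareigis, Hopf--Galois structures on $L/K$ correspond to regular subgroups $N$ of $\mathrm{Sym}(G/G')$ (transitive with trivial point stabilisers) normalised by $\lambda(G)$; the isomorphism class of $N$ is the type of the structure. ''Cyclic type'' means $N$ is cyclic (necessarily of order $[L:K]$). An extension $L'/K$ is parallel to $L/K$ if $L'$ is an intermediate field of $\widetilde{L}/K$ with $[L':K]=[L:K]$. *)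

(* Defs.v *)
From HB Require Import structures.
From mathcomp Require Import all_boot all_order all_algebra all_fingroup.
From mathcomp Require Import cyclic.
From mathcomp Require Import all_field.
Set Implicit Arguments. Unset Strict Implicit. Unset Printing Implicit Defensive.
Import GRing.Theory.

Local Open Scope group_scope.

(* The left-translation permutation lambda(g) : A |-> g *: A of {set gT};
   on the left cosets hG' it is hG' |-> ghG'. *)
Definition lambda (gT : finGroupType) (g : gT) : {perm {set gT}} :=
  perm (@lcoset_inj gT g).

(* Greither--Pareigis: L/K admits a Hopf--Galois structure of cyclic type iff
   there is a cyclic regular subgroup N of Sym(G/G') normalised by lambda(G).
   Here G/G' is the set of left cosets lcosets G' G, and Sym(G/G') is
   realised as the permutations of {set gT} supported on G/G'. *)
Definition cyclic_HGS_grp (gT : finGroupType) (G G' : {group gT}) : Prop :=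
  exists N : {group {perm {set gT}}},
    [/\ N \subset Sym (lcosets G' G),
        [transitive N, on lcosets G' G | 'P],
        (forall x, x \in lcosets G' G -> 'C_N[x | 'P] = 1),
        (forall g, g \in G -> lambda g \in 'N(N))
      & cyclic N].

Local Open Scope ring_scope.

Definition is_normal_closure (F : fieldType) (E : splittingFieldType F)
    (K M Mt : {subfield E}) : Prop :=
  [/\ (K <= M)%VS, (M <= Mt)%VS, normalField K Mt &
      forall M' : {subfield E}, (M <= M')%VS -> normalField K M' -> (Mt <= M')%VS].

Definition admits_cyclic_HGS (F : fieldType) (E : splittingFieldType F)
    (K M : {subfield E}) : Prop :=
  exists Mt : {subfield E},
    is_normal_closure K M Mt /\ cyclic_HGS_grp 'Gal(Mt / K) 'Gal(Mt / M).

(* L'/K is parallel to L/K, where Lt is the normal closure of L/K. *)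
Definition parallel (F : fieldType) (E : splittingFieldType F)
    (K L Lt L' : {subfield E}) : Prop :=
  [/\ (K <= L')%VS, (L' <= Lt)%VS & \dim_K L' = \dim_K L].

(* Main.v *)
Require Import Defs.
From HB Require Import structures.
From mathcomp Require Import all_boot all_order all_algebra all_fingroup.
From mathcomp Require Import cyclic.
From mathcomp Require Import all_field.
From mathcomp Require Import pgroup sylow.
From mathcomp Require Import ring zify.

(* A cyclic Hopf--Galois structure on G/H amounts to an affine action of G on
   Z/n, n = |G : H|, in which H is the stabiliser of 0: g acts as
   z |-> u(g) z + f(g).  This description is insensitive to replacing G by a
   quotient by a normal subgroup contained in H, so that all intermediate
   fields can be treated inside one group G = Gal(Lt/K).

   When n = 2^e, squaring e - 2 times kills u and makes f divisible by 2^(e-2),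
   so the powers g^(2^(e-2)) lie in a normal subgroup D of G of order at most
   2^s.  If M is normal of order 2^s and contains D, then G/M has no cyclic
   subgroup of index at most 2; but a regular affine group on Z/2^e always has
   one, as it contains an element with u = 1 mod 4 and f not divisible by 4.

   If s = 1 and c has order 2^e, a subgroup M of order 2 not contained in <c>
   has the normal complement <c>, which acts on G/M as the translations of Z/n.
   Otherwise G/M is dihedral or abelian of type (2^(e-1), 2), and both have an
   explicit regular affine action on Z/2^e. *)

Set Implicit Arguments. Unset Strict Implicit. Unset Printing Implicit Defensive.
Import GRing.Theory.
Local Open Scope ring_scope.

(** * Affine coordinates on a finite group *)

(** Only [f] is asked to respect products: its surjectivity then forces [u] to be multiplicative on
    [G]. Values outside [G] are arbitrary. *)
Definition affine_coord (gT : finGroupType) (G H : {set gT}) (n : nat)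
    (f u : gT -> 'Z_n) : Prop :=
  [/\ {in G &, forall g h, f (g * h)%g = u g * f h + f g},
      {in G, forall g, (f g == 0) = (g \in H)} &
      forall z, exists2 g, g \in G & f g = z].

Lemma coord1 (gT : finGroupType) (G H : {group gT}) n (f u : gT -> 'Z_n) :
  affine_coord G H f u -> f 1%g = 0.
Proof. by case=> _ fH _; apply/eqP; rewrite fH ?group1. Qed.

Lemma mult1 (gT : finGroupType) (G H : {group gT}) n (f u : gT -> 'Z_n) :
  affine_coord G H f u -> u 1%g = 1.
Proof.
move=> fu; have f1 := coord1 fu; case: fu => fM _ /(_ 1)[g gG fg].
by have := fM _ _ (group1 G) gG; rewrite mul1g fg f1 mulr1 addr0.
Qed.

(** Comparing f((gh)k) with f(g(hk)) for a [k] with f(k) = 1 isolates the multipliers. *)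
Lemma multM (gT : finGroupType) (G H : {group gT}) n (f u : gT -> 'Z_n) :
  affine_coord G H f u -> {in G &, forall g h, u (g * h)%g = u g * u h}.
Proof.
case=> fM _ /(_ 1)[k kG fk] g h gG hG.
have := fM _ _ (groupM gG hG) kG; rewrite -mulgA !fM ?groupM // fk.
by move/esym/(canRL (addrK _)); rewrite !mulr1 => ->; ring.
Qed.

Lemma multV (gT : finGroupType) (G H : {group gT}) n (f u : gT -> 'Z_n) :
  affine_coord G H f u -> {in G, forall g, u g * u g^-1%g = 1}.
Proof.
by move=> fu g gG; rewrite -(multM fu) ?groupV // mulgV (mult1 fu).
Qed.

(** One has f(h) = u(g) f(g^-1 h) + f(g), and u(g) is a unit. *)
Lemma coord_eq (gT : finGroupType) (G H : {group gT}) n (f u : gT -> 'Z_n) :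
  affine_coord G H f u ->
  {in G &, forall g h, (f g == f h) = (g^-1 * h \in H)%g}.
Proof.
move=> fu g h gG hG; have uV := multV fu gG; case: fu => fM fH _.
have kG : (g^-1 * h)%g \in G by rewrite groupM ?groupV.
rewrite -fH // -{1}(mulKVg g h) fM // eq_sym -subr_eq0 addrK.
apply/eqP/eqP => [E|->]; last by rewrite mulr0.
by rewrite -[LHS]mul1r -uV mulrAC E mul0r.
Qed.

Lemma multX (gT : finGroupType) (G H : {group gT}) n (f u : gT -> 'Z_n) :
  affine_coord G H f u -> {in G, forall g k, u (g ^+ k)%g = u g ^+ k}.
Proof.
move=> fu g gG; elim=> [|k IH]; first by rewrite expg0 (mult1 fu).
by rewrite expgS (multM fu) ?groupX // IH exprS.
Qed.

Lemma coordX (gT : finGroupType) (G H : {group gT}) n (f u : gT -> 'Z_n) :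
  affine_coord G H f u ->
  {in G, forall g k, f (g ^+ k)%g = (\sum_(i < k) u g ^+ i) * f g}.
Proof.
move=> fu g gG; elim=> [|k IH]; first by rewrite expg0 (coord1 fu) big_ord0 mul0r.
rewrite expgSr; case: (fu) => fM _ _.
rewrite fM ?groupX // IH (multX fu) // big_ord_recr /=. ring.
Qed.

(** * Arithmetic of Z/2^e *)

Lemma expn2_gt1 e : (0 < e)%N -> (1 < 2 ^ e)%N.
Proof. by move=> e0; apply: leq_ltn_trans e0 (ltn_expl e _). Qed.

Lemma natrZ_eq0 e k : (0 < e)%N -> (k%:R == 0 :> 'Z_(2 ^ e)) = (2 ^ e %| k)%N.
Proof.
move=> e0; have n1 := expn2_gt1 e0.
by rewrite -val_eqE /= val_Zp_nat.
Qed.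

Lemma expr2_eq0 e : (0 < e)%N -> 2 ^+ e = 0 :> 'Z_(2 ^ e).
Proof. by move=> e0; apply/eqP; rewrite -natrX natrZ_eq0. Qed.

Lemma geom_double (R : comNzRingType) (w : R) k :
  \sum_(i < k.*2) w ^+ i = (\sum_(i < k) w ^+ i) * (1 + w ^+ k).
Proof.
rewrite -addnn big_split_ord /= mulrDr mulr1; congr (_ + _).
by rewrite big_distrl /=; apply: eq_bigr => i _; rewrite exprD mulrC.
Qed.

Lemma unit_mod4 e (x y : 'Z_(2 ^ e)) : (0 < e)%N -> x * y = 1 ->
  (exists t, x = 1 + 4 * t) \/ (exists t, x = - 1 + 4 * t).
Proof.
move=> e0 xy; have n1 := expn2_gt1 e0.
have xo : odd x.
  (* An even [x] would make this product vanish, since 2^e = 0. *)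
  have : (x * y * 2 ^+ e.-1)%R != 0.
    rewrite xy mul1r -natrX natrZ_eq0 //; apply/negP => /dvdn_leq.
    by rewrite expn_gt0 => /(_ isT); rewrite leqNgt ltn_exp2l // prednK // leqnn.
  apply: contraR => xe; rewrite -[x]natr_Zp -[X in X %:R]odd_double_half (negPf xe).
  rewrite add0n -mul2n natrM.
  have -> (z : 'Z_(2 ^ e)) : 2 * z * y * 2 ^+ e.-1 = 2 ^+ e.-1.+1 * (z * y).
    by rewrite exprS; ring.
  by rewrite prednK // expr2_eq0 // mul0r.
have := odd_double_half (val x); rewrite xo => Ex.
have := odd_double_half (val x)./2; set q := (val x)./2./2 => Eq.
rewrite -[x]natr_Zp -Ex -Eq; case: odd; [right|left].
  (* Here x = 3 + 4q = -1 + 4(q + 1). *)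
  by exists (q%:R + 1); rewrite /= -!muln2 !(natrD, natrM); ring.
by exists q%:R; rewrite /= -!muln2 !(natrD, natrM); ring.
Qed.

Lemma pow_mod4 (R : comNzRingType) (t : R) k : exists r, (1 + 4 * t) ^+ k = 1 + 4 * r.
Proof.
elim: k => [|k [r IH]]; first by exists 0; ring.
by exists (t + r + 4 * t * r); rewrite exprS IH; ring.
Qed.

(** Doubling the number k of terms multiplies the sum by 1 + w^k, which is 2 mod 4 when w is 1 mod
    4; each doubling thus gains exactly one factor 2. *)
Lemma geom_mod4 (R : comNzRingType) (t : R) j :
  exists r, \sum_(i < 2 ^ j) (1 + 4 * t) ^+ i = 2 ^+ j * (1 + 2 * r).
Proof.
elim: j => [|j [r IH]].
  by exists 0; rewrite expn0 big_ord1; ring.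
rewrite expnS mul2n geom_double IH; have [q ->] := pow_mod4 t (2 ^ j).
by exists (r + q + 2 * r * q); rewrite exprS; ring.
Qed.

(** For an arbitrary unit w the factors 1 + w^k are still even, but may be divisible by 4, so only
    divisibility remains. *)
Lemma geom_dvd e (w y : 'Z_(2 ^ e)) j : (0 < e)%N -> w * y = 1 ->
  exists r, \sum_(i < 2 ^ j) w ^+ i = 2 ^+ j * r.
Proof.
move=> e0 wy.
have wk k : exists r, 1 + w ^+ k = 2 * r.
  have [|[r ->]|[r ->]] := @unit_mod4 e (w ^+ k) (y ^+ k) e0.
  - by rewrite -exprMn wy expr1n.
  - by exists (1 + 2 * r); ring.
  - by exists (2 * r); ring.
elim: j => [|j [r IH]]; first by exists 1; rewrite expn0 big_ord1; ring.
rewrite expnS mul2n geom_double IH; have [q ->] := wk (2 ^ j)%N.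
by exists (r * q); rewrite exprS; ring.
Qed.

(** The square of a unit is 1 mod 8, and each further squaring gains a factor 2, so w^(2^k) is 1 mod
    2^(k+2). *)
Lemma unit_pow e (w y : 'Z_(2 ^ e)) k : (0 < e)%N -> w * y = 1 -> 
  (0 < k)%N -> (e <= k.+2)%N -> w ^+ (2 ^ k) = 1.
Proof.
move=> e0 wy; case: k => // k _ ek.
have [r w2] : exists r, w ^+ 2 = 1 + 8 * r.
  have [|[r ->]|[r ->]] := @unit_mod4 e w y e0 => //.
  - by exists (r + 2 * r * r); ring.
  - by exists (2 * r * r - r); ring.
have [q ->] : exists q, w ^+ (2 ^ k.+1) = 1 + 2 ^+ k.+3 * q.
  elim: k {ek} => [|k [q IH]]; first by exists r; rewrite w2 !exprS; ring.
  exists (q + 2 ^+ k.+2 * q * q); rewrite expnS mulnC exprM IH !exprS; ring.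
rewrite -(subnK ek) exprD expr2_eq0 //; ring.
Qed.

(** * Cyclic regular subgroups and affine coordinates *)

(** Serves to choose exponents for the elements of a subgroup only; [u0] inhabits [U] for the other
    arguments. *)
Lemma fin_choice_in (T : finType) (U : Type) (u0 : U) (A : {pred T}) (P : T -> U -> Prop) :
  (forall x, x \in A -> exists y, P x y) ->
  exists f : T -> U, forall x, x \in A -> P x (f x).
Proof.
move=> exP; apply: (@fin_all_exists T (fun=> U) (fun x y => x \in A -> P x y)) => x.
have [/exP[y Py]|_] := boolP (x \in A); first by exists y.
by exists u0.
Qed.

Lemma lambdaE (gT : finGroupType) (g : gT) (A : {set gT}) : lambda g A = (g *: A)%g.
Proof. by rewrite permE. Qed.

(** If x generates N, regularity makes i -> x^i(H) a bijection from Z/n to the cosets. Then f(g) is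
    the logarithm of gH, and u(g) the exponent to which conjugation by [lambda g] raises x. *)
Lemma cyclic_HGS_coord (gT : finGroupType) (G H : {group gT}) n :
  H \subset G -> (1 < n)%N -> #|G : H|%g = n -> cyclic_HGS_grp G H ->
  exists f u : gT -> 'Z_n, affine_coord G H f u.
Proof.
move=> sHG n1 iGH [N [sNS trN regN nN /cyclicP[x defN]]].
set X := lcosets H G in sNS trN regN.
have X1 : (H : {set gT}) \in X by apply/lcosetsP; exists 1%g; rewrite ?group1 ?lcoset1.
have Xg g : g \in G -> (g *: H)%g \in X by move=> gG; apply/lcosetsP; exists g.
have ox : #[x]%g = n.
  rewrite /order -defN -iGH -card_lcosets -/X -(atransP trN _ X1).
  by rewrite card_orbit_in ?subsetT // regN // indexg1.
have xH k l : ((x ^+ k)%g H == (x ^+ l)%g H) = (k%:R == l%:R :> 'Z_n).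
  rewrite -[RHS]val_eqE /= !val_Zp_nat // -ox -eq_expg_mod_order.
  apply/eqP/eqP => [E|->//].
  (* This element of N fixes the point H, hence is trivial by regularity. *)
  have /set1gP : (x ^+ k * x ^- l)%g \in (1%g : {set {perm {set gT}}}).
    rewrite -(regN _ X1) inE; apply/andP; split.
      by rewrite defN groupM ?groupV ?mem_cycle.
    by apply/astab1P; rewrite /= apermE permM E -permM mulgV perm1.
  by move/(canRL (mulgK _)); rewrite invgK mul1g.
have /(fin_choice_in 0%N)[p px] g : g \in G -> exists k, (x ^+ k)%g H = (g *: H)%g.
  move=> gG; have [a] := atransP2 trN X1 (Xg g gG).
  by rewrite defN => /cycleP[k ->] E; exists k.
have /(fin_choice_in 0%N)[q qx] g : g \in G -> exists k, (x ^ lambda g)%g = (x ^+ k)%g.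
  move=> gG; have : (x ^ lambda g)%g \in N by rewrite memJ_norm ?nN // defN cycle_id.
  by rewrite defN => /cycleP[k ->]; exists k.
exists (fun g => (p g)%:R), (fun g => (q g)%:R); split.
- move=> g h gG hG; rewrite -natrM -natrD; apply/eqP; rewrite -xH px ?groupM //.
  (* Permutations compose from left to right: x^(p g) first moves H to gH, and x^(q g) is the
     conjugate of x by [lambda g], so the second factor moves gH to ghH. *)
  rewrite addnC expgD permM px // expgM -qx // -conjXg -(lambdaE g) permJ px //.
  by rewrite lambdaE lcosetM.
- move=> g gG /=; rewrite -[0]/(0%:R) -xH px // expg0 perm1.
  apply/eqP/idP => [<-|]; first by rewrite lcoset_refl.
  by move/lcoset_id.
- move=> z; have : (x ^+ z)%g H \in X.
    rewrite -(atransP trN _ X1); apply/orbitP; exists (x ^+ z)%g => //.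
    by rewrite defN mem_cycle.
  case/lcosetsP => g gG E; exists g => //; rewrite -[z]natr_Zp; apply/eqP.
  by rewrite -xH px // E.
Qed.

(** The fibres of [f] are the left cosets of H, and [lambda g] moves the fibre over z to the one
    over u(g) z + f(g). The generator of N is the shift z -> z + 1. *)
Lemma coord_cyclic_HGS (gT : finGroupType) (G H : {group gT}) n (f u : gT -> 'Z_n) :
  H \subset G -> affine_coord G H f u -> cyclic_HGS_grp G H.
Proof.
move=> sHG fu; case: (fu) => fM fH fS.
pose T z := [set g in G | f g == z].
have TE g : g \in G -> (g *: H)%g = T (f g).
  move=> gG; apply/setP=> h; rewrite mem_lcoset inE.
  case hG: (h \in G) => /=; first by rewrite eq_sym (coord_eq fu).
  apply: contraFF hG => /(subsetP sHG) kG.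
  by rewrite -(mulKVg g h) groupM.
have T_inj : injective T.
  move=> y z /setP E; have [g gG fg] := fS y; have := E g.
  by rewrite !inE gG fg eqxx => /esym/eqP.
set X := lcosets H G.
have XT z : T z \in X.
  by have [g gG <-] := fS z; apply/lcosetsP; exists g; rewrite ?TE.
have XP A : reflect (exists z, A = T z) (A \in X).
  apply: (iffP idP) => [/lcosetsP[g gG ->]|[z ->]//].
  by exists (f g); rewrite TE.
(* The shift by 1 on cosets, extended by the identity to all of [{set gT}]. *)
pose eta A := if A \in X then T (f (repr A) + 1) else A.
have fT z : f (repr (T z)) = z.
  have [g gG fg] := fS z; have /mem_repr : g \in T z by rewrite inE gG fg eqxx.
  by rewrite inE => /andP[_ /eqP].
have etaT z : eta (T z) = T (z + 1) by rewrite /eta XT fT.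
have etaN A : A \notin X -> eta A = A by rewrite /eta => /negPf->.
have eta_inj : injective eta.
  move=> A B; case: (boolP (A \in X)) => [/XP[y ->]|nA];
    case: (boolP (B \in X)) => [/XP[z ->]|nB]; rewrite ?etaT ?etaN //.
  - by move/T_inj/addIr->.
  - by move=> E; move: nB; rewrite -E XT.
  - by move=> E; move: nA; rewrite E XT.
pose x := perm eta_inj.
have xT k z : (x ^+ k)%g (T z) = T (z + k%:R).
  elim: k => [|k IH]; first by rewrite expg0 perm1 addr0.
  by rewrite expgSr permM IH permE etaT -addrA -natr1.
have xN k A : A \notin X -> (x ^+ k)%g A = A.
  by move=> nA; apply: permX_fix; rewrite permE etaN.
have lT g z : g \in G -> lambda g (T z) = T (u g * z + f g).
  move=> gG; have [h hG <-] := fS z.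
  by rewrite lambdaE -TE // -fM // -TE ?groupM // lcosetM.
have lN g A : g \in G -> A \notin X -> lambda g A \notin X.
  move=> gG; apply: contra => /lcosetsP[h hG]; rewrite lambdaE => E.
  apply/lcosetsP; exists (g^-1 * h)%g; first by rewrite groupM ?groupV.
  by rewrite lcosetM -E -lcosetM mulVg lcoset1.
exists <[x]>%G; split.
- rewrite cycle_subG inE; apply/subsetP => A; rewrite inE; apply: contraR => nA.
  by rewrite permE etaN.
- apply/imsetP; exists (T 0) => //; apply/setP => A; apply/XP/orbitP.
    by case=> z ->; exists (x ^+ z)%g; rewrite ?mem_cycle //= apermE xT add0r natr_Zp.
  by case=> _ /cycleP[k ->] <-; exists (0 + k%:R); rewrite /= apermE xT.
- move=> A /XP[z ->]; apply/trivgP/subsetP => a /setIP[/cycleP[k ->] /astab1P].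
  rewrite /= apermE xT => /T_inj/(canRL (addKr _)); rewrite addNr => k0.
  apply/set1gP/permP => B; rewrite perm1.
  by have [/XP[y ->]|/xN//] := boolP (B \in X); rewrite xT k0 addr0.
- move=> g gG; rewrite inE -cycleJ cycle_subG.
  (* Conjugating z -> z + 1 by z -> u z + f gives z -> z + u. *)
  suff -> : (x ^ lambda g)%g = (x ^+ u g)%g by rewrite mem_cycle.
  apply/permP => B; rewrite -(permKV (lambda g) B); move: (_ B) => {}B.
  rewrite permJ; have [/XP[y ->]|nB] := boolP (B \in X).
    by rewrite (permE eta_inj) etaT !lT // xT natr_Zp; congr T; ring.
  by rewrite (permE eta_inj) etaN // xN // lN.
- exact: cycle_cyclic.
Qed.

(** * Transport of coordinates along homomorphisms *)

Lemma coord_morphpre (aT rT : finGroupType) (G H : {group aT}) (K : {group rT})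
    (phi : {morphism G >-> rT}) n (f u : rT -> 'Z_n) :
  {in G, forall g, (phi g \in K) = (g \in H)} ->
  affine_coord (phi @* G)%g K f u ->
  affine_coord G H (f \o phi) (u \o phi).
Proof.
move=> KH [fM fK fS]; split=> /=.
- by move=> g h gG hG /=; rewrite morphM // fM // mem_morphim.
- by move=> g gG /=; rewrite fK ?mem_morphim // KH.
- by move=> z; have [_ /morphimP[g _ gG ->] <-] := fS z; exists g.
Qed.

(** The hypothesis makes [f] constant on the fibres of [phi], so coordinates on the image can be
    read off through any section [l]. *)
Lemma coord_morphim (aT rT : finGroupType) (G H : {group aT}) (K : {group rT})
    (phi : {morphism G >-> rT}) n (f u : aT -> 'Z_n) :
  {in G, forall g, (phi g \in K) = (g \in H)} ->
  affine_coord G H f u ->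
  exists f' u' : rT -> 'Z_n, affine_coord (phi @* G)%g K f' u'.
Proof.
move=> KH fu; case: (fu) => fM fH fS.
have /(fin_choice_in 1%g)[l lP] y : y \in (phi @* G)%g -> exists g, g \in G /\ phi g = y.
  by case/morphimP=> g _ gG ->; exists g.
have f_phi : {in G &, forall g h, phi g = phi h -> f g = f h}.
  move=> g h gG hG E; apply/eqP; rewrite (coord_eq fu) // -KH ?groupM ?groupV //.
  by rewrite morphM ?groupV // morphV // E mulVg.
exists (f \o l), (u \o l); split=> /=.
- move=> y z yG zG /=; have [lG ly] := lP y yG; have [lG' lz] := lP z zG.
  have [lG2 lyz] := lP _ (groupM yG zG).
  by rewrite -fM //; apply: f_phi; rewrite ?groupM // morphM // ly lz.
- by move=> y yG /=; have [lG ly] := lP y yG; rewrite fH // -KH // ly.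
- move=> z; have [g gG <-] := fS z; have pG := mem_morphim phi gG gG.
  by exists (phi g) => //=; have [lG lE] := lP _ pG; apply: f_phi.
Qed.

(** * Quotients without affine coordinates *)

(** Group-theoretic counterpart of [Lt] being the normal closure of L/K; it makes the affine action
    faithful. *)
Definition core_free (gT : finGroupType) (G H : {group gT}) : Prop :=
  forall A : {group gT}, (A <| G)%g -> A \subset H -> A :=: 1%g.

(** The elements acting as translations by a vector killed by 2^j; the subgroup D of the overview is
    of this form. *)
Definition transl_torsion (gT : finGroupType) (G : {group gT}) n
    (f u : gT -> 'Z_n) j : {set gT} :=
  [set g in G | (u g == 1) && (2 ^+ j * f g == 0)].

Lemma coordJ (gT : finGroupType) (G H : {group gT}) n (f u : gT -> 'Z_n) :
  affine_coord G H f u -> {in G &, forall g h, u g = 1 ->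
    u (g ^ h)%g = 1 /\ f (g ^ h)%g = u h^-1%g * f g}.
Proof.
move=> fu g h gG hG ug; have uV := multV fu hG; have uM := multM fu.
have f1 := coord1 fu; case: (fu) => fM _ _.
rewrite /conjg !uM ?groupM ?groupV // ug mul1r mulrC; split=> //.
have : f (h^-1 * h)%g = 0 by rewrite mulVg.
rewrite !fM ?groupM ?groupV // ug mul1r mulrDr addrAC => ->; ring.
Qed.

Lemma transl_torsion_normal (gT : finGroupType) (G H : {group gT}) n
    (f u : gT -> 'Z_n) j :
  affine_coord G H f u ->
  exists2 D : {group gT}, D :=: transl_torsion G f u j & (D <| G)%g.
Proof.
move=> fu; have uM := multM fu; case: (fu) => fM _ _.
have gD : group_set (transl_torsion G f u j).
  apply/group_setP; split=> [|g h]; rewrite !inE.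
    by rewrite group1 (mult1 fu) (coord1 fu) mulr0 !eqxx.
  move=> /and3P[gG /eqP ug /eqP fg] /and3P[hG /eqP uh /eqP fh].
  rewrite groupM // uM // fM // ug uh mulr1 mul1r mulrDr fg fh addr0 !eqxx //.
exists (Group gD) => //; apply/andP; split.
  by apply/subsetP => g; rewrite inE => /andP[].
apply/normsP => h hG; apply/setP => g; rewrite mem_conjg !inE.
have hVG := groupVr hG.
rewrite groupJr ?groupV //; case gG: (g \in G) => //=.
apply/idP/idP => /andP[/eqP ug /eqP fg].
  have gJ : (g ^ h^-1)%g \in G by rewrite groupJ.
  have [E1 E2] := coordJ fu gJ hG ug; rewrite conjgKV in E1 E2.
  by rewrite E1 E2 mulrCA fg mulr0 !eqxx.
have [-> ->] := coordJ fu gG hVG ug.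
by rewrite mulrCA fg mulr0 !eqxx.
Qed.

Lemma core_free_faithful (gT : finGroupType) (G H : {group gT}) n
    (f u : gT -> 'Z_n) :
  affine_coord G H f u -> core_free G H ->
  {in G, forall g, u g = 1 -> f g = 0 -> g = 1%g}.
Proof.
(* For j = 0 the torsion subgroup is the kernel of the action, which is normal and contained in
   H. *)
move=> fu cf g gG ug fg; have [D dD nD] := transl_torsion_normal 0 fu.
have D1 : D :=: 1%g.
  apply: cf nD _; apply/subsetP => h; rewrite dD inE expr0 mul1r => /and3P[hG _ fh].
  by case: fu => _ fH _; rewrite -fH.
have : g \in D by rewrite dD inE gG ug fg mulr0 !eqxx.
by rewrite D1 => /set1gP.
Qed.

Lemma torsion_val e j (z : 'Z_(2 ^ e)) : (0 < e)%N -> (j <= e)%N ->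
  2 ^+ j * z = 0 -> exists2 y : 'I_(2 ^ j), true & z = (2 ^ (e - j) * y)%:R.
Proof.
move=> e0 je; rewrite -[z]natr_Zp -natrX -natrM => /eqP.
rewrite natrZ_eq0 // -{1}(subnKC je) expnD dvdn_pmul2l ?expn_gt0 // => dz.
have yj : (z %/ 2 ^ (e - j) < 2 ^ j)%N.
  rewrite ltn_divLR ?expn_gt0 // -expnD subnKC //.
  by have := ltn_ord z; rewrite [X in (_ < X)%N]Zp_cast // expn2_gt1.
by exists (Ordinal yj); rewrite //= mulnC divnK.
Qed.

(** By faithfulness [f] is injective on translations, and Z/2^e has 2^j elements killed by 2^j. *)
Lemma card_transl_torsion (gT : finGroupType) (G H : {group gT}) e
    (f u : gT -> 'Z_(2 ^ e)) j :
  (0 < e)%N -> (j <= e)%N -> affine_coord G H f u -> core_free G H ->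
  (#|transl_torsion G f u j| <= 2 ^ j)%N.
Proof.
move=> e0 je fu cf; have uM := multM fu; have uV := multV fu.
have ff := core_free_faithful fu cf.
have f_inj : {in transl_torsion G f u j &, injective f}.
  move=> g h; rewrite !inE => /and3P[gG /eqP ug _] /and3P[hG /eqP uh _] E.
  have kG : (g^-1 * h)%g \in G by rewrite groupM ?groupV.
  have : (g^-1 * h)%g = 1%g.
    apply: ff => //; first by rewrite uM ?groupV // uh mulr1 -(uV _ gG) ug mul1r.
    by apply/eqP; case: (fu) => _ fH _; rewrite fH // -(coord_eq fu) // E.
  by move/(canRL (mulKVg _)); rewrite mulg1.
rewrite -(card_in_imset f_inj).
have sub : f @: transl_torsion G f u j \subset
    [set (2 ^ (e - j) * y)%:R | y : 'I_(2 ^ j)].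
  apply/subsetP => y /imsetP[g]; rewrite inE => /and3P[_ _ /eqP fg] ->.
  by have [x _ ->] := torsion_val e0 je fg; apply: imset_f.
apply: leq_trans (subset_leq_card sub) _.
by apply: leq_trans (leq_imset_card _ _) _; rewrite card_ord.
Qed.

Lemma coord_pow2 (gT : finGroupType) (G H : {group gT}) e
    (f u : gT -> 'Z_(2 ^ e)) g j :
  (0 < e)%N -> affine_coord G H f u -> g \in G ->
  exists r, f (g ^+ (2 ^ j))%g = 2 ^+ j * r.
Proof.
move=> e0 fu gG; rewrite (coordX fu) //.
by have [r ->] := geom_dvd j e0 (multV fu gG); exists (r * f g); rewrite mulrA.
Qed.

Lemma expg_exponent (gT : finGroupType) (G H : {group gT}) e
    (f u : gT -> 'Z_(2 ^ e)) g :
  (0 < e)%N -> affine_coord G H f u -> core_free G H -> g \in G ->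
  (g ^+ (2 ^ e) = 1)%g.
Proof.
move=> e0 fu cf gG; apply: (core_free_faithful fu cf); first by rewrite groupX.
  by rewrite (multX fu) // (unit_pow e0 (multV fu gG)) // ltnW.
by have [r ->] := coord_pow2 e e0 fu gG; rewrite expr2_eq0 // mul0r.
Qed.

Lemma coord_pgroup (gT : finGroupType) (G H : {group gT}) e
    (f u : gT -> 'Z_(2 ^ e)) :
  (0 < e)%N -> affine_coord G H f u -> core_free G H -> (2.-group G)%g.
Proof.
move=> e0 fu cf; apply/pgroupP => p p_pr /(Cauchy p_pr)[g gG og].
have := expg_exponent e0 fu cf gG => /eqP; rewrite -order_dvdn og.
by rewrite Euclid_dvdX // dvdn_prime2 // => /andP[].
Qed.

(** For h = g^(2^(e-2)), u(h) = 1 and f(h) is a multiple of 2^(e-2), hence killed by 4. Unless g has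
    order 2^e, also h^2 = 1, and 2 already kills f(h). With e > 2 the exponent e - 2 is positive, as
    [unit_pow] requires. *)
Lemma pow_transl_torsion (gT : finGroupType) (G H : {group gT}) e
    (f u : gT -> 'Z_(2 ^ e)) g :
  (2 < e)%N -> affine_coord G H f u -> core_free G H -> g \in G ->
  (g ^+ (2 ^ (e - 2)))%g \in transl_torsion G f u (#[g]%g == 2 ^ e)%N.+1.
Proof.
move=> e2 fu cf gG; have e0 : (0 < e)%N by apply: leq_trans e2.
have ug : u (g ^+ (2 ^ (e - 2)))%g = 1.
  by rewrite (multX fu) // (unit_pow e0 (multV fu gG)) ?subn_gt0 // -addn2 subnK // ltnW.
rewrite inE groupX // ug eqxx /=.
have [r fr] := coord_pow2 (e - 2) e0 fu gG.
have [_|og] := eqVneq #[g]%g (2 ^ e)%N.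
  by rewrite fr mulrA -exprD subnKC ?expr2_eq0 ?mul0r // ltnW.
have : (g ^+ (2 ^ (e - 2)) * g ^+ (2 ^ (e - 2)) = 1)%g.
  rewrite -expgD addnn -mul2n -expnS; apply/eqP; rewrite -order_dvdn.
  have := expg_exponent e0 fu cf gG => /eqP; rewrite -order_dvdn.
  case/dvdn_pfactor => // k ke Ek; rewrite Ek dvdn_Pexp2l //.
  move: og; rewrite Ek eqn_exp2l //; lia.
move/(congr1 f); rewrite (coord1 fu); case: (fu) => fM _ _.
by rewrite fM ?groupX // ug mul1r => E; rewrite expr1 mulr2n mulrDl mul1r E.
Qed.

Lemma coord_pow_notin (gT : finGroupType) (G H : {group gT}) e
    (f u : gT -> 'Z_(2 ^ e)) :
  (1 < e)%N -> affine_coord G H f u ->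
  exists2 g, g \in G & (g ^+ (2 ^ (e - 2)))%g \notin H.
Proof.
move=> e1 fu; have e0 : (0 < e)%N by apply: leq_trans e1.
have uV := multV fu; have uM := multM fu; case: (fu) => fM fH fS.
have half_neq0 : 2 ^+ e.-1 != 0 :> 'Z_(2 ^ e).
  by rewrite -natrX natrZ_eq0 // dvdn_Pexp2l // -ltnNge prednK.
have half (z : 'Z_(2 ^ e)) : 2 ^+ e.-1 * (1 + 2 * z) = 2 ^+ e.-1.
  have : 2 ^+ e.-1.+1 = 0 :> 'Z_(2 ^ e) by rewrite prednK // expr2_eq0.
  by rewrite exprS => E; rewrite mulrDr mulrA (mulrC _ 2) E mul0r addr0 mulr1.
have Ee : e.-1 = (e - 2).+1 by lia.
(* It suffices that u(g) is 1 mod 4 and that f(g) is 2 or odd, oddness being stated after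
   doubling. *)
have notin g t z : g \in G -> u g = 1 + 4 * t ->
    2 * f g = 2 * (1 + 2 * z) \/ f g = 2 -> (g ^+ (2 ^ (e - 2)))%g \notin H.
  move=> gG ug fg; rewrite -fH ?groupX // (coordX fu) // ug.
  have [r ->] := geom_mod4 t (e - 2); case: fg => fg.
    (* For odd f(g), doubling the coordinate of the power gives 2^(e-1) times an odd number, which
       is 2^(e-1). *)
    apply: contraNneq half_neq0 => /(congr1 ( *%R 2)); rewrite mulr0 => <-.
    rewrite mulrCA fg -(half (r + z + 2 * r * z)) Ee exprS.
    by apply/eqP; ring.
  by rewrite fg mulrAC -exprSr -Ee half.
have [g1 g1G fg1] := fS 1; have [g2 g2G fg2] := fS 2.
have [[t ut]|[t ut]] := unit_mod4 e0 (uV _ g1G).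
  by exists g1 => //; apply: (notin _ t 0) => //; left; rewrite fg1 mulr0 addr0.
have [[v uv]|[v uv]] := unit_mod4 e0 (uV _ g2G).
  by exists g2 => //; apply: (notin _ v 0) => //; right.
(* Two multipliers that are -1 mod 4 have product 1 mod 4, and f(g1 g2) = 2 u(g1) + 1 is odd. *)
exists (g1 * g2)%g; first by rewrite groupM.
apply: (notin _ (4 * t * v - t - v) (u g1)); rewrite ?groupM //.
  by rewrite uM // ut uv; ring.
by left; rewrite fM // fg1 fg2; ring.
Qed.

(** The p-group G/D has normal subgroups of every order dividing its own; one of them is pulled back
    to G. *)
Lemma pgroup_normal_above (gT : finGroupType) (p s : nat) (G D : {group gT}) :
  (p.-group G)%g -> prime p -> (D <| G)%g -> (#|D| <= p ^ s)%N -> (p ^ s %| #|G|)%N ->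
  exists H : {group gT}, [/\ D \subset H, (H <| G)%g & #|H| = (p ^ s)%N].
Proof.
move=> pG p_pr nDG leD dvG; have sDG := normal_sub nDG.
have [k Dk] := p_natP (pgroupS sDG pG).
have [m Gm] := p_natP pG.
have p1 := prime_gt1 p_pr.
have ks : (k <= s)%N by rewrite -(leq_exp2l _ _ p1) -Dk.
have sm : (s <= m)%N by rewrite -(dvdn_Pexp2l _ _ p1) -Gm.
have cGD : #|(G / D)%g| = (p ^ (m - k))%N.
  by rewrite card_quotient ?normal_norm // -divgS // Gm Dk -expnB ?prime_gt0 // (leq_trans ks).
have /normal_pgroup : (p.-group (G / D))%g by rewrite quotient_pgroup.
move/(_ (s - k)%N _ (normal_refl _)).
rewrite cGD pfactorK // leq_sub2r // => /(_ isT)[Q [_ nQ cQ]].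
exists (coset D @*^-1 Q)%G; split.
- exact: sub_cosetpre.
- by rewrite -(quotientGK nDG) cosetpre_normal.
- by rewrite card_cosetpre cQ Dk -expnD subnKC.
Qed.

(* The bound e is the number of elements of {1, -1} in Z/2^e. *)
Lemma card_stab_small (gT : finGroupType) (G H : {group gT}) e
    (f u : gT -> 'Z_(2 ^ e)) :
  (0 < e <= 2)%N -> H \subset G -> affine_coord G H f u -> core_free G H ->
  {in G, forall g, u g = 1 \/ u g = -1} /\ (#|H| <= e)%N.
Proof.
case/andP => e0 e2 sHG fu cf; have ff := core_free_faithful fu cf.
have uM := multM fu; have uV := multV fu.
have four0 : 4 = 0 :> 'Z_(2 ^ e).
  have -> : 4 = 2 ^+ (e + (2 - e)) :> 'Z_(2 ^ e) by rewrite subnKC //; ring.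
  by rewrite exprD expr2_eq0 // mul0r.
have upm : {in G, forall g, u g = 1 \/ u g = -1}.
  move=> g gG; have [[t ->]|[t ->]] := unit_mod4 e0 (uV _ gG); rewrite four0 mul0r addr0; auto.
split=> //.
have u_inj : {in H &, injective u}.
  move=> g h gH hH E; have gG := subsetP sHG g gH; have hG := subsetP sHG h hH.
  have : (g^-1 * h)%g = 1%g.
    apply: ff; rewrite ?groupM ?groupV //.
      by rewrite uM ?groupV // -E mulrC uV.
    by apply/eqP; case: (fu) => _ fH _; rewrite fH ?groupM ?groupV.
  by move/(canRL (mulKVg _)); rewrite mulg1.
rewrite -(card_in_imset u_inj).
have sub : u @: H \subset [set 1; -1].
  apply/subsetP => _ /imsetP[g gH ->]; rewrite !inE.
  by case: (upm g (subsetP sHG g gH)) => ->; rewrite eqxx ?orbT.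
apply: leq_trans (subset_leq_card sub) _; rewrite cards2.
case: e e0 e2 {f u fu ff uM uV four0 upm u_inj sub} => [|[|[|//]]] // _ _.
Qed.

(** The involution s of H has f(s) = 0, so u(s) = -1 by faithfulness. If f(g) = 1, then g or gs is
    the translation by 1, of order 2^e. *)
Lemma small_full_order (gT : finGroupType) (G H : {group gT}) e
    (f u : gT -> 'Z_(2 ^ e)) :
  (0 < e <= 2)%N -> H \subset G -> affine_coord G H f u -> core_free G H ->
  #|H| = 2%N -> exists2 g, g \in G & #[g]%g = (2 ^ e)%N.
Proof.
move=> e02 sHG fu cf H2; have [upm cH] := card_stab_small e02 sHG fu cf.
have e0 : (0 < e)%N by case/andP: e02.
have uM := multM fu; case: (fu) => fM fH fS.
have full g : g \in G -> u g = 1 -> f g = 1 -> #[g]%g = (2 ^ e)%N.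
  move=> gG ug fg; apply/eqP; rewrite eqn_dvd order_dvdn (expg_exponent e0 fu cf) // eqxx /=.
  rewrite -natrZ_eq0 // -(coord1 fu) -(expg_order g) (coordX fu) // fg ug mulr1.
  by under eq_bigr do rewrite expr1n; rewrite sumr_const card_ord.
have [s sH s1] : exists2 s, s \in H & s != 1%g.
  by apply/trivgPn; rewrite trivg_card1 H2.
have sG := subsetP sHG s sH.
have fs : f s = 0 by apply/eqP; rewrite fH.
have us : u s = -1.
  by case: (upm s sG) => // us; case/eqP: s1; apply: (core_free_faithful fu cf).
have [g gG fg] := fS 1; case: (upm g gG) => ug; first by exists g => //; apply: full.
exists (g * s)%g; first by rewrite groupM.
by apply: full; rewrite ?groupM // ?uM ?fM // ?ug ?us ?fs ?fg ?mulrNN ?mulr1 // mulr0 add0r.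
Qed.

Lemma normal_without_coord (gT : finGroupType) (G H : {group gT}) e s
    (f u : gT -> 'Z_(2 ^ e)) :
  (0 < e)%N -> H \subset G -> affine_coord G H f u -> core_free G H ->
  #|H| = (2 ^ s)%N ->
  (s = 1%N /\ ~ (exists2 g, g \in G & #[g]%g = 2 ^ e)%N) \/ (2 <= s)%N ->
  exists M : {group gT}, [/\ (M <| G)%g, #|M| = (2 ^ s)%N &
    forall f' u' : gT -> 'Z_(2 ^ e), ~ affine_coord G M f' u'].
Proof.
move=> e0 sHG fu cf cH hs.
(* For e <= 2, the case s = 1 would give an element of order 2^e, and s >= 2 would contradict |H| <=
   e. *)
have e2 : (2 < e)%N.
  rewrite ltnNge; apply/negP => e2; have e02 : (0 < e <= 2)%N by rewrite e0.
  case: hs => [[s1]|s2].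
    by case; apply: small_full_order e02 sHG fu cf _; rewrite cH s1.
  have [_] := card_stab_small e02 sHG fu cf; apply/negP; rewrite -ltnNge cH.
  by apply: leq_ltn_trans e2 _; rewrite (@ltn_exp2l 2 1).
(* So j = 1 if s = 1 and j = 2 if s >= 2: enough to catch all powers g^(2^(e-2)), while |D| <= 2^j
   <= 2^s. *)
pose j := minn s 2.
have [D dD nD] := transl_torsion_normal j fu.
have js : (j <= s)%N by rewrite geq_minl.
have je : (j <= e)%N by apply: leq_trans (geq_minr _ _) (ltnW e2).
have cD : (#|D| <= 2 ^ s)%N.
  by rewrite dD; apply: leq_trans (card_transl_torsion e0 je fu cf) _; rewrite leq_exp2l.
have pG := coord_pgroup e0 fu cf.
have dG : (2 ^ s %| #|G|)%N by rewrite -cH cardSg.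
have [M [sDM nM cM]] := pgroup_normal_above pG (isT : prime 2) nD cD dG.
exists M; split=> // f' u' fu'; have [g gG /negP[]] := coord_pow_notin (ltnW e2) fu'.
apply: (subsetP sDM); rewrite dD.
have := pow_transl_torsion e2 fu cf gG; rewrite !inE => /and3P[-> -> /=].
rewrite /j; case: hs => [[s1 no]|s2].
  have [og|_] := eqVneq #[g]%g (2 ^ e)%N; first by case: no; exists g.
  by rewrite s1.
rewrite (minn_idPr s2); have [//|_ /eqP E] := eqVneq #[g]%g (2 ^ e)%N.
by rewrite exprS -mulrA E mulr0.
Qed.

(** * Quotients with affine coordinates *)

(** A counting argument: f(g) = f(h) gives f(g^-1 h) = f(g^-1 g) = 0, so [f] separates the n cosets
    of H and takes all n values. *)
Lemma coord_surj (gT : finGroupType) (G H : {group gT}) n (f u : gT -> 'Z_n) :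
  (1 < n)%N -> H \subset G -> #|G : H|%g = n ->
  {in G &, forall g h, f (g * h)%g = u g * f h + f g} ->
  {in G, forall g, (f g == 0) = (g \in H)} -> 
  affine_coord G H f u.
Proof.
move=> n1 sHG iGH fM fH; split=> // z.
have f_eq : {in G &, forall g h, f g = f h -> (g *: H = h *: H)%g}.
  move=> g h gG hG E; apply/esym/lcoset_eqP; rewrite mem_lcoset.
  rewrite -fH ?groupM ?groupV // fM ?groupV // -E -fM ?groupV // mulVg.
  by rewrite fH ?group1.
have rP A : A \in lcosets H G -> repr A \in G /\ A = (repr A *: H)%g.
  case/lcosetsP=> g gG ->.
  have rA : repr (g *: H)%g \in (g *: H)%g := mem_repr g (lcoset_refl H g).
  split; last by apply/esym/lcoset_eqP.
  move: rA; rewrite mem_lcoset => /(subsetP sHG).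
  by rewrite groupMl ?groupV.
have inj : {in lcosets H G &, injective (f \o repr)}.
  move=> A B /rP[aG EA] /rP[bG EB] /= E; by rewrite EA EB; apply: f_eq.
have /eqP full : [set (f \o repr) A | A in lcosets H G] == [set: 'Z_n].
  rewrite eqEcard subsetT (card_in_imset inj) card_lcosets iGH.
  by rewrite cardsT card_ord [X in (X <= _)%N](Zp_cast n1) leqnn.
have : z \in [set: 'Z_n] by rewrite inE.
by rewrite -full => /imsetP[A /rP[aG _] ->]; exists (repr A).
Qed.

(** Here f(g) is the i with g in c^i H, and u(g) the exponent with g c g^-1 = c^u(g). *)
Lemma cyclic_complement_coord (gT : finGroupType) (G H : {group gT}) (c : gT) n :
  (1 < n)%N -> #[c]%g = n -> (<[c]> <| G)%g -> (<[c]> * H)%g = G ->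
  (<[c]> :&: H = 1)%g ->
  exists f u : gT -> 'Z_n, affine_coord G H f u.
Proof.
move=> n1 oc nCG CHG tiCH.
have cG : c \in G by rewrite -cycle_subG normal_sub.
have sHG : H \subset G by rewrite -CHG mulG_subr.
have /(fin_choice_in 0%N)[p pP] g : g \in G -> exists i, (c ^- i * g)%g \in H.
  by rewrite -{1}CHG => /mulsgP[_ h /cycleP[i ->] hH ->]; exists i; rewrite mulKg.
have /(fin_choice_in 0%N)[q qP] g : g \in G -> exists i, (g * c * g^-1)%g = (c ^+ i)%g.
  move=> gG; apply/cycleP; rewrite -[(_ * _)%g]/(_ * c * _)%g.
  rewrite -{1}(invgK g) -mulgA -/(conjg c g^-1) memJ_norm ?cycle_id // groupV.
  exact: (subsetP (normal_norm nCG)).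
have uniq g i : g \in G -> (c ^- i * g)%g \in H -> (p g)%:R = i%:R :> 'Z_n.
  move=> gG ig; have : (c ^+ i == c ^+ p g)%g.
    have : (c ^- p g * c ^+ i)%g \in (<[c]> :&: H)%g.
      rewrite inE groupM ?groupV ?mem_cycle //=.
      have -> : (c ^- p g * c ^+ i = (c ^- p g * g) * (c ^- i * g)^-1)%g.
        by rewrite invMg invgK mulgA mulgK.
      by rewrite groupM ?groupV // pP.
    by rewrite tiCH => /set1gP/(canRL (mulKVg _)); rewrite mulg1 => ->.
  rewrite eq_expg_mod_order oc => /eqP E; apply: val_inj.
  by rewrite /= !val_Zp_nat // E.
exists (fun g => (p g)%:R), (fun g => (q g)%:R); split.
- move=> g h gG hG; rewrite -natrM -natrD; apply: uniq; first by rewrite groupM.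
  have -> : (c ^- (q g * p h + p g) * (g * h) = (c ^- p g * g) * (c ^- p h * h))%g.
    rewrite expgD invMg expgM -qP //.
    have -> : ((g * c * g^-1) ^+ p h = g * c ^+ p h * g^-1)%g.
      by have := conjXg c g^-1 (p h); rewrite /conjg invgK !mulgA => <-.
    by rewrite !invMg invgK !mulgA mulgKV.
  by rewrite groupM ?pP.
- move=> g gG; apply/eqP/idP => [p0|gH].
    have := pP g gG; have : (c ^+ p g == c ^+ 0)%g.
      rewrite eq_expg_mod_order oc; move: p0 => /(congr1 val) /=.
      by rewrite val_Zp_nat // => ->; rewrite mod0n.
    by rewrite expg0 => /eqP->; rewrite invg1 mul1g.
  by rewrite (uniq _ 0%N) // expg0 invg1 mul1g.
- move=> z; exists (c ^+ z)%g; first by rewrite groupX.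
  by rewrite (uniq _ z) ?natr_Zp ?groupX // mulVg.
Qed.

(** * Explicit actions for the quotients by the involution of a cyclic subgroup of index 2 *)

(** The sum has the same 2-adic valuation as i: its parity is that of i, and passing from k to 2k
    terms multiplies it by a number that is 2 mod 4. *)
Lemma geom_dvdn t m i :
  (2 ^ m %| \sum_(k < i) (1 + 4 * t) ^ k = (2 ^ m %| i))%N.
Proof.
have w4 k : exists r, ((1 + 4 * t) ^ k = 1 + 4 * r)%N.
  elim: k => [|k [r IH]]; first by exists 0%N.
  by exists (t + r + 4 * t * r)%N; rewrite expnS IH; ring.
have dbl k : (\sum_(i < k.*2) (1 + 4 * t) ^ i =
    (\sum_(i < k) (1 + 4 * t) ^ i) * (1 + (1 + 4 * t) ^ k))%N.
  rewrite -addnn big_split_ord /= mulnDr muln1; congr addn.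
  by rewrite big_distrl /=; apply: eq_bigr => j _; rewrite expnD mulnC.
have par k : odd (\sum_(i < k) (1 + 4 * t) ^ i)%N = odd k.
  elim: k => [|k IH]; first by rewrite big_ord0.
  by rewrite big_ord_recr /= oddD IH oddX oddD oddM orbT addbT.
elim: m i => [|m IH] i; first by rewrite !dvd1n.
case oi : (odd i).
  have ndv k : odd k -> (2 ^ m.+1 %| k)%N = false.
    move=> ok; apply: contraTF ok => dk; rewrite -dvdn2.
    by apply: dvdn_trans dk; rewrite expnS dvdn_mulr.
  by rewrite !ndv ?par.
have := odd_double_half i; rewrite oi add0n => <-; rewrite dbl.
have [r ->] := w4 i./2; rewrite -mul2n.
have -> : (1 + (1 + 4 * r) = 2 * (1 + 2 * r))%N by ring.
rewrite mulnCA expnS !dvdn_pmul2l // Gauss_dvdl ?IH //.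
by rewrite coprimeXl // coprime2n oddD oddM.
Qed.

Lemma geom_sum_pow (R : comNzRingType) (t : R) k :
  (1 + 4 * t) ^+ k = 1 + 4 * t * \sum_(i < k) (1 + 4 * t) ^+ i.
Proof.
elim: k => [|k IH]; first by rewrite big_ord0; ring.
by rewrite big_ord_recr exprS IH /=; ring.
Qed.

(** With a = 2b + 1 one has a^2 - 1 = 4b(b + 1), and only one of b, b + 1 is even. *)
Lemma square_one_mod2e e a : (0 < e)%N -> (2 ^ e %| a ^ 2 - 1)%N -> (0 < a)%N ->
  (2 ^ e.-1 %| a - 1)%N \/ (2 ^ e.-1 %| a + 1)%N.
Proof.
case: e => // e _ /= dv a0.
have oa : odd a.
  have : (2 %| a ^ 2 - 1)%N by apply: dvdn_trans dv; rewrite expnS dvdn_mulr.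
  by rewrite dvdn2 oddB ?expn_gt0 ?a0 // oddX /= addbT negbK.
have := odd_double_half a; rewrite oa; set b := a./2 => Ea.
case: e dv => [|e] dv; first by left; rewrite dvd1n.
have : (2 ^ e %| b * (b + 1))%N.
  move: dv; have -> : (a ^ 2 - 1 = 2 * (2 * (b * (b + 1))))%N.
    by rewrite -Ea -mul2n; lia.
  by rewrite !expnS !dvdn_pmul2l.
have -> : (a - 1 = 2 * b)%N by lia.
have -> : (a + 1 = 2 * (b + 1))%N by lia.
rewrite expnS !dvdn_pmul2l //; have [ob|eb] := boolP (odd b).
  by rewrite mulnC Gauss_dvdl ?coprimeXl ?coprime2n // => ->; right.
by rewrite Gauss_dvdl ?coprimeXl ?coprime2n ?oddD ?addbT // => ->; left.
Qed.

(* The coordinate given to c^i s^b when c acts on Z/2^e as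
   z |-> (1 + 4t) z + 2 and s as z |-> - z - 1. *)
Definition twist e (t i : nat) (b : bool) : 'Z_(2 ^ e) :=
  2 * (\sum_(k < i) (1 + 4 * t%:R) ^+ k) - b%:R * (1 + 4 * t%:R) ^+ i.

Lemma geom_add (R : comNzRingType) (w : R) i j :
  \sum_(k < i + j) w ^+ k = \sum_(k < i) w ^+ k + w ^+ i * \sum_(k < j) w ^+ k.
Proof.
rewrite big_split_ord /= big_distrr /=; congr (_ + _).
by apply: eq_bigr => k _; rewrite exprD.
Qed.

Lemma double_geom_eq0 e t i : (0 < e)%N ->
  (2 * (\sum_(k < i) (1 + 4 * t%:R) ^+ k) == 0 :> 'Z_(2 ^ e)) = (2 ^ e.-1 %| i)%N.
Proof.
move=> e0; rewrite -(geom_dvdn t) -(@dvdn_pmul2l 2) // -expnS prednK //.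
rewrite -natrZ_eq0 // natrM natr_sum; congr (_ * _ == 0).
by apply: eq_bigr => k _; rewrite natrX natrD natrM.
Qed.

Lemma twist_false_eq0 e t i : (0 < e)%N ->
  (twist e t i false == 0) = (2 ^ e.-1 %| i)%N.
Proof. by move=> e0; rewrite /twist mul0r subr0 double_geom_eq0. Qed.

(** The value is odd, which multiplication by 2^(e-1) detects. *)
Lemma twist_true_neq0 e t i : (0 < e)%N -> twist e t i true != 0.
Proof.
move=> e0; rewrite /twist geom_sum_pow; set S := \sum_(k < i) _.
have half_neq0 : 2 ^+ e.-1 != 0 :> 'Z_(2 ^ e).
  by rewrite -natrX natrZ_eq0 // dvdn_Pexp2l // -ltnNge prednK.
apply: contraNneq half_neq0 => /(congr1 ( *%R (2 ^+ e.-1))); rewrite mulr0 => E.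
have : 2 ^+ e.-1.+1 = 0 :> 'Z_(2 ^ e) by rewrite prednK // expr2_eq0.
rewrite exprS => E2; apply/eqP; rewrite -[LHS]addr0 -E.
have -> : 2 ^+ e.-1 + 2 ^+ e.-1 * (2 * S - true%:R * (1 + 4 * t%:R * S)) =
  2 * 2 ^+ e.-1 * (S - 2 * t%:R * S) :> 'Z_(2 ^ e) by rewrite /=; ring.
by rewrite E2 mul0r.
Qed.

Lemma twistD e t i j b :
  twist e t (i + j) b = twist e t i false + (1 + 4 * t%:R) ^+ i * twist e t j b.
Proof. by rewrite /twist geom_add exprD /=; ring. Qed.

Lemma pow_period e t j : (0 < e)%N -> (2 ^ e.-1 %| j)%N ->
  (1 + 4 * t%:R) ^+ j = 1 :> 'Z_(2 ^ e).
Proof.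
move=> e0; rewrite -(double_geom_eq0 t) // => /eqP E; rewrite geom_sum_pow.
set S := \sum_(k < j) _ in E *.
have -> : 4 * t%:R * S = 2 * t%:R * (2 * S) by ring.
by rewrite E mulr0 addr0.
Qed.

(** The power c^(2^(e-1)) acts trivially, so the action factors through the quotient by the
    involution of <c>. *)
Lemma twist_period e t i j b : (0 < e)%N -> (2 ^ e.-1 %| j)%N ->
  twist e t (j + i) b = twist e t i b.
Proof.
move=> e0 dj; rewrite twistD pow_period // mul1r.
by move: dj; rewrite -(twist_false_eq0 t) // => /eqP->; rewrite add0r.
Qed.

(* The witness t = 0 realises a dihedral group (s negates c modulo 2^(e-1)),
   and t = 1 the units of Z/2^(e+1) acting by multiplication on {1 + 2z}. *)
Lemma twist_conj e a : (0 < e)%N -> (0 < a)%N -> (2 ^ e %| a ^ 2 - 1)%N ->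
  exists t, forall i k b, twist e t (i + a * k) (~~ b) =
    twist e t i true - (1 + 4 * t%:R) ^+ i * twist e t k b.
Proof.
(* The identity is the cocycle law for c^i s times c^k s^b, where s c^k = c^(ak) s. The two
   witnesses answer a = 1 and a = -1 mod 2^(e-1). *)
move=> e0 a0 da; have [d1|d1] := square_one_mod2e e0 da a0; [exists 1%N|exists 0%N] => i k b.
  have -> : (i + a * k = (a - 1) * k + (i + k))%N.
    by rewrite -{1}(subnK a0) mulnDl mul1n; lia.
  rewrite twist_period ?dvdn_mulr // /twist geom_add exprD !geom_sum_pow.
  by case: b; rewrite /=; ring.
have w1 j : (1 + 4 * 0%:R) ^+ j = 1 :> 'Z_(2 ^ e) by rewrite mulr0 addr0 expr1n.
have S1 j : \sum_(m < j) (1 + 4 * 0%:R) ^+ m = j%:R :> 'Z_(2 ^ e).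
  by under eq_bigr do rewrite w1; rewrite sumr_const card_ord.
have : (2 ^ e %| 2 * (a + 1))%N by rewrite -(prednK e0) expnS dvdn_pmul2l.
rewrite -natrZ_eq0 // natrM natrD => /eqP E.
rewrite /twist !S1 !w1 natrD natrM.
have -> : 2 * (i%:R + a%:R * k%:R) =
  2 * (a%:R + 1%:R) * k%:R + 2 * (i%:R - k%:R) :> 'Z_(2 ^ e) by ring.
by rewrite E; case: b; rewrite /=; ring.
Qed.

Lemma cyclic_index2_quotient_coord (gT : finGroupType) (G H : {group gT}) (c s : gT) e :
  (0 < e)%N -> #[c]%g = (2 ^ e)%N -> #[s]%g = 2%N -> s \notin <[c]>%g ->
  (<[c]> <| G)%g -> (<[c]> * <[s]>)%g = G -> H \subset <[c]>%g -> #|H| = 2%N ->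
  exists f u : gT -> 'Z_(2 ^ e), affine_coord G H f u.
Proof.
move=> e0 oc os sC nCG CsG sHC cH.
have sG : s \in G by rewrite -CsG (subsetP (mulG_subr _ _)) ?cycle_id.
have ss : (s * s = 1)%g by rewrite -expg2 -os expg_order.
have sV : (s^-1 = s)%g by apply/eqP; rewrite eq_invg_mul ss.
have TI : (<[c]> :&: <[s]> = 1)%g.
  by rewrite setIC prime_TIg -?orderE ?os // cycle_subG.
have iGH : #|G : H|%g = (2 ^ e)%N.
  have sHG : H \subset G := subset_trans sHC (normal_sub nCG).
  by rewrite -divgS // -CsG TI_cardMg // -!orderE oc os cH mulnK.
have [a sca] : exists a, (s * c * s = c ^+ a)%g.
  apply/cycleP; have : (c ^ s)%g \in <[c]>%g.
    by rewrite memJ_norm ?cycle_id // (subsetP (normal_norm nCG)).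
  by rewrite /conjg sV mulgA.
have sck k : (s * c ^+ k = c ^+ (a * k) * s)%g.
  have -> : (c ^+ (a * k) = (c ^ s) ^+ k)%g by rewrite expgM -sca /conjg sV mulgA.
  by rewrite -conjXg /conjg sV !mulgA -[RHS]mulgA ss mulg1.
(* Conjugating c twice by the involution s gives c back. *)
have a2 : (a ^ 2 = 1 %[mod 2 ^ e])%N.
  apply/eqP; rewrite -oc -eq_expg_mod_order expg1.
  have := sck a; rewrite -{1}sca !mulgA ss mul1g => /mulIg E.
  by rewrite -mulnn -E.
have a0 : (0 < a)%N.
  rewrite lt0n; apply/eqP => a0; move: a2; rewrite a0 mod0n => /esym/eqP.
  by rewrite modn_small ?expn2_gt1.
have da : (2 ^ e %| a ^ 2 - 1)%N.
  by rewrite -eqn_mod_dvd ?expn_gt0 ?a0 //; apply/eqP.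
have [t tw] := twist_conj e0 a0 da.
have /(fin_choice_in (0%N, false))[p pP] g : g \in G ->
    exists q : nat * bool, g = (c ^+ q.1 * s ^+ q.2)%g.
  rewrite -{1}CsG => /mulsgP[_ _ /cycleP[i ->] /cycleP[k ->] ->].
  exists (i, odd k); congr (_ * _)%g; rewrite -{1}(odd_double_half k) expgD.
  by rewrite -mul2n expgM expg2 ss expg1n mulg1.
(* Exponents of c are determined modulo 2^e, a multiple of the period 2^(e-1) of [twist], so any
   expression of g may be used. *)
have uniq g i b : g \in G -> g = (c ^+ i * s ^+ nat_of_bool b)%g ->
    twist e t (p g).1 (p g).2 = twist e t i b.
  move=> gG Eg; have := pP g gG; case: (p g) => k l /= Eg'.
  have E : (c ^- k * c ^+ i = s ^+ nat_of_bool l * s ^- nat_of_bool b)%g.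
    apply: (canLR (mulKg _)); rewrite mulgA; apply: (canRL (mulgK _)).
    by rewrite -Eg -Eg'.
  have : (c ^- k * c ^+ i)%g \in (<[c]> :&: <[s]>)%g.
    by rewrite inE groupM ?groupV ?mem_cycle //= E groupM ?groupV ?mem_cycle.
  rewrite TI => /set1gP E1.
  have -> : b = l.
    move: E; rewrite E1 => /esym; case: b l {Eg Eg'} => [] [] //=.
      by rewrite mul1g expg1 sV => s1; move: os; rewrite s1 order1.
    by rewrite invg1 mulg1 expg1 => s1; move: os; rewrite s1 order1.
  have /eqP : (c ^+ i = c ^+ k)%g by rewrite -[RHS]mulg1 -E1 mulKVg.
  rewrite eq_expg_mod_order oc => /eqP Eik.
  have dd m : (2 ^ e.-1 %| m * 2 ^ e)%N.
    by rewrite dvdn_mull // dvdn_Pexp2l // leq_pred.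
  by rewrite (divn_eq i (2 ^ e)) (divn_eq k (2 ^ e)) !twist_period // Eik.
exists (fun g => twist e t (p g).1 (p g).2),
  (fun g => if (p g).2 then - (1 + 4 * t%:R) ^+ (p g).1 else (1 + 4 * t%:R) ^+ (p g).1).
apply: coord_surj; rewrite ?expn2_gt1 //.
- exact: subset_trans sHC (normal_sub nCG).
- move=> g h gG hG; have := pP g gG; have := pP h hG.
  case: (p g) (p h) => [i [|]] [k l] /= Eh Eg.
    rewrite addrC mulNr -tw; apply: uniq; first by rewrite groupM.
    rewrite Eg Eh expgD -!mulgA; congr (_ * _)%g.
    rewrite mulgA expg1 sck -mulgA; congr (_ * _)%g.
    by case: l {Eh}; rewrite /= ?expg0 ?expg1 ?mulg1.
  rewrite addrC -twistD; apply: uniq; first by rewrite groupM.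
  by rewrite Eg Eh expg0 mulg1 mulgA expgD.
- move=> g gG; have := pP g gG; case: (p g) => [i [|]] /= Eg.
    rewrite (negPf (twist_true_neq0 _ _ e0)); apply/esym/negbTE.
    apply: contra sC => /(subsetP sHC); rewrite Eg expg1.
    by rewrite groupMl ?mem_cycle.
  rewrite twist_false_eq0 // Eg expg0 mulg1.
  have -> : H = <[c ^+ (2 ^ e.-1)]>%G.
    apply/set1P; have <- : (#[c]%g %/ 2 = 2 ^ e.-1)%N by rewrite oc -{1}(prednK e0) expnS mulKn.
    by rewrite -cycle_sub_group ?inE ?sHC ?cH // oc dvdn_exp.
  apply/idP/idP => [/dvdnP[m ->]|/cycleP[m]].
    by rewrite mulnC expgM mem_cycle.
  rewrite -expgM => /eqP; rewrite eq_expg_mod_order oc => /eqP E.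
  have : (2 ^ e.-1 %| i %% 2 ^ e)%N.
    by rewrite E -(prednK e0) /dvdn modn_dvdm ?dvdn_Pexp2l //= -/(dvdn _ _) dvdn_mulr.
  by rewrite /dvdn modn_dvdm // dvdn_Pexp2l // leq_pred.
Qed.

Lemma parallel_coord (gT : finGroupType) (G H M : {group gT}) (c : gT) e :
  (0 < e)%N -> core_free G H -> H \subset G -> #|H| = 2%N -> #|G| = (2 ^ e * 2)%N ->
  c \in G -> #[c]%g = (2 ^ e)%N -> M \subset G -> #|M| = 2%N ->
  exists f u : gT -> 'Z_(2 ^ e), affine_coord G M f u.
Proof.
move=> e0 cf sHG cH cG cinG oc sMG cM.
have sCG : <[c]>%g \subset G by rewrite cycle_subG.
have iC : #|G : <[c]>|%g = 2%N by rewrite -divgS // cG -orderE oc mulKn ?expn_gt0.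
have nCG := index2_normal sCG iC.
have full (X : {group gT}) : X \subset G -> #|X| = 2%N -> ~~ (X \subset <[c]>%g) ->
    (<[c]> :&: X = 1)%g /\ (<[c]> * X)%g = G.
  move=> sXG cX nX; have TI : (<[c]> :&: X = 1)%g by rewrite setIC prime_TIg ?cX.
  split=> //; apply/eqP; rewrite eqEcard mul_subG //= TI_cardMg // -orderE oc cX.
  by rewrite cG.
have [sMC|nMC] := boolP (M \subset <[c]>%g); last first.
  have [TI E] := full M sMG cM nMC.
  by apply: cyclic_complement_coord oc nCG E TI; apply: expn2_gt1.
(* Subgroups of the cyclic normal subgroup <c> are normal in G, so core-freeness keeps H out of <c>.
   A generator of H is then the involution s complementing <c>. *)
have nHC : ~~ (H \subset <[c]>%g).
  apply/negP => sHC; have : H :=: 1%g.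
    apply: cf (subxx _); apply: char_normal_trans nCG.
    by rewrite sub_cyclic_char ?cycle_cyclic.
  by move=> H1; move: cH; rewrite H1 cards1.
have [TI E] := full H sHG cH nHC.
have [s defH] : exists s, H :=: <[s]>%g.
  by apply/cyclicP; apply: prime_cyclic; rewrite cH.
apply: (@cyclic_index2_quotient_coord _ G M c s) => //.
- by rewrite orderE -defH.
- by rewrite -cycle_subG -defH.
- by rewrite -defH.
Qed.

(** * Normal closures and change of the ambient Galois group *)

Lemma normal_closure_uniq (F : fieldType) (E : splittingFieldType F)
    (K L M N : {subfield E}) :
  is_normal_closure K L M -> is_normal_closure K L N -> M = N.
Proof.
move=> [KL LM nM minM] [_ LN nN minN].
by apply/val_inj/eqP; rewrite eqEsubv minM ?minN.
Qed.

(** Adjoin to K all roots of the minimal polynomial of a primitive element of L/K. *)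
Lemma exists_normal_closure (F : fieldType) (E : splittingFieldType F)
    (K L : {subfield E}) : (K <= L)%VS -> separable K L ->
  exists2 M, is_normal_closure K L M & galois K M.
Proof.
move=> sKL sepKL; pose x := separable_generator K L.
have defL : <<K; x>>%VS = L.
  have := eq_adjoin_separable_generator sepKL sKL; exact: esym.
have [r Er] := splitting_field_normal K x.
have sM : splittingFieldFor K (minPoly K x) <<K & r>>%AS.
  by exists r => //; rewrite (eqP Er) eqpxx.
have gM : galois K <<K & r>>%AS.
  apply/splitting_galoisField; exists (minPoly K x); split=> //; first exact: minPolyOver.
  exact: separable_generatorP.
exists <<K & r>>%AS => //; split=> //.
- rewrite -defL; apply/FadjoinP; split; first exact: subv_adjoin_seq.
  have : x \in r by rewrite -root_prod_XsubC -(eqP Er) root_minPoly.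
  exact: seqv_sub_adjoin.
- by case/and3P: gM.
move=> N sLN /normalFieldP nN; have xN : x \in N.
  by apply: (subvP sLN); rewrite -defL memv_adjoin.
have [q qN Eq] := nN x xN; apply/Fadjoin_seqP; split; first exact: subv_trans sKL sLN.
move=> y yr; have : y \in q by rewrite -root_prod_XsubC -Eq (eqP Er) root_prod_XsubC.
by move/(allP qN).
Qed.

Lemma normal_closure_galois (F : fieldType) (E : splittingFieldType F)
    (K L Lt : {subfield E}) : (K <= L)%VS -> separable K L ->
  is_normal_closure K L Lt -> galois K Lt.
Proof.
move=> sKL sepKL nc; have [M ncM gM] := exists_normal_closure sKL sepKL.
by rewrite (normal_closure_uniq nc ncM).
Qed.

Lemma normalField_cast_gal (F : fieldType) (E : splittingFieldType F)
    (K L M Lt : {subfield E}) (sKM : (K <= M <= Lt)%VS) (nKM : normalField K M) :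
  (K <= L)%VS -> (L <= M)%VS ->
  {in ('Gal(Lt / K))%g, forall g,
    (normalField_cast_morphism sKM nKM g \in ('Gal(M / L))%g) = (g \in ('Gal(Lt / L))%g)}.
Proof.
move=> sKL sLM g gK; case/andP: (sKM) => _ sMLt; rewrite /=.
have cE := normalField_cast_eq sKM nKM gK.
rewrite !gal_kHom ?(subv_trans sLM) //.
by apply/kAHomP/kAHomP => cL a La; have := cL a La; rewrite cE // (subvP sLM).
Qed.

(** Restriction maps Gal(Lt/K) onto Gal(M/K), and Gal(Lt/L) is the preimage of Gal(M/L). This lets
    M, the normal closure of an intermediate field, be replaced by the larger field [Lt]. *)
Lemma coord_field_transfer (F : fieldType) (E : splittingFieldType F)
    (K L M Lt : {subfield E}) n : galois K Lt ->
  (K <= L)%VS -> (L <= M)%VS -> (M <= Lt)%VS -> normalField K M ->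
  (exists f u : gal_of Lt -> 'Z_n, affine_coord ('Gal(Lt / K))%g ('Gal(Lt / L))%g f u) <->
  (exists f u : gal_of M -> 'Z_n, affine_coord ('Gal(M / K))%g ('Gal(M / L))%g f u).
Proof.
move=> gK sKL sLM sML nM.
have sKM : (K <= M <= Lt)%VS by rewrite (subv_trans sKL).
have cg := normalField_cast_gal sKM nM sKL sLM.
have img := normalField_img gK sKM nM.
split=> [[f [u fu]]|[f [u fu]]].
  by have := coord_morphim cg fu; rewrite /= img.
exists (f \o normalField_cast M), (u \o normalField_cast M).
by apply: (coord_morphpre cg); rewrite /= img.
Qed.


Lemma galois_index (F : fieldType) (E : splittingFieldType F) (K M Lt : {subfield E}) :
  galois K Lt -> (K <= M)%VS -> (M <= Lt)%VS ->
  #|'Gal(Lt / K) : 'Gal(Lt / M)|%g = \dim_K M.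
Proof.
move=> gK sKM sML; have /galois_fixedField fM : galois M Lt.
  by apply: galoisS gK; rewrite sKM.
by rewrite -dim_fixed_galois ?galS // fM.
Qed.

(** The fixed field of a normal subgroup inside Gal(Lt/L) is normal over K and contains L, so by
    minimality it is [Lt]. *)
Lemma normal_closure_core_free (F : fieldType) (E : splittingFieldType F)
    (K L Lt : {subfield E}) :
  galois K Lt -> is_normal_closure K L Lt ->
  core_free ('Gal(Lt / K))%G ('Gal(Lt / L))%G.
Proof.
move=> gK [_ sLLt _ minLt] A nA sAH.
have /and3P[_ _ nFA] := normal_fixedField_galois gK nA.
have sLt : (Lt <= fixedField A)%VS.
  by apply: (minLt [aspace of fixedField A]) => //; rewrite -galois_connection.
have fA : fixedField A = Lt by apply/eqP; rewrite eqEsubv sLt fixedField_bound.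
by apply/card1_trivg; rewrite dim_fixedField fA divnn adim_gt0.
Qed.

(** * Hopf--Galois structures on parallel extensions *)

Theorem theorem1p5 (F : fieldType) (E : splittingFieldType F)
    (K L Lt : {subfield E}) (e : nat) :
  (K <= L)%VS -> separable K L ->
  (0 < e)%N -> \dim_K L = (2 ^ e)%N ->
  is_normal_closure K L Lt ->
  admits_cyclic_HGS K L ->
  exists s : nat,
    #|('Gal(Lt / K))%g| = (2 ^ s * \dim_K L)%N /\
    ((s = 1%N -> (exists2 g, g \in ('Gal(Lt / K))%g & #[g]%g = \dim_K L) ->
        forall L' : {subfield E}, parallel K L Lt L' -> admits_cyclic_HGS K L') /\
     ((s = 1%N /\ ~ (exists2 g, g \in ('Gal(Lt / K))%g & #[g]%g = \dim_K L))
        \/ (2 <= s)%N ->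
        exists L' : {subfield E},
          parallel K L Lt L' /\ normalField K L' /\ ~ admits_cyclic_HGS K L')).
Proof.
move=> sKL sepKL e0 dimL nc [Mt [ncM HGS]].
have n1 := expn2_gt1 e0.
rewrite {Mt ncM}(normal_closure_uniq ncM nc) in HGS.
have gK := normal_closure_galois sKL sepKL nc.
have cf := normal_closure_core_free gK nc.
have [_ sLLt nKLt minLt] := nc; have sKLt := subv_trans sKL sLLt.
have sHG : 'Gal(Lt / L)%g \subset 'Gal(Lt / K)%g := galS Lt sKL.
have iGH : #|'Gal(Lt / K) : 'Gal(Lt / L)|%g = (2 ^ e)%N by rewrite galois_index.
have [f [u fu]] := cyclic_HGS_coord sHG n1 iGH HGS.
have pG := coord_pgroup e0 fu cf.
have [s cH] := p_natP (pgroupS sHG pG).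
have cG : #|('Gal(Lt / K))%g| = (2 ^ s * 2 ^ e)%N by rewrite -(Lagrange sHG) cH iGH.
exists s; rewrite dimL; split=> //; split.
  move=> s1 [c cinG oc] L' [sKL' sL'Lt dimL'].
  have sMG : 'Gal(Lt / L')%g \subset 'Gal(Lt / K)%g := galS Lt sKL'.
  have cM : #|('Gal(Lt / L'))%g| = 2%N.
    apply/eqP; rewrite -(@eqn_pmul2r (2 ^ e)) ?expn_gt0 // -{1}dimL -dimL'.
    by rewrite -(galois_index gK sKL' sL'Lt) Lagrange // cG s1.
  have co : exists f' u' : gal_of Lt -> 'Z_(2 ^ e),
      affine_coord ('Gal(Lt / K))%g ('Gal(Lt / L'))%g f' u'.
    apply: (parallel_coord e0 cf sHG _ _ cinG oc sMG cM).
      by rewrite cH s1.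
    by rewrite cG s1 mulnC.
  have sepL' : separable K L' by case/and3P: gK => _ sepLt _; apply: separableSr sepLt.
  (* A structure on L'/K refers to the normal closure of L' itself, which may be smaller than
     [Lt]. *)
  have [M' ncM' _] := exists_normal_closure sKL' sepL'.
  have [_ sL'M' nM' minM'] := ncM'.
  have sM'Lt := minM' Lt sL'Lt nKLt.
  have [f' [u' fu']] := (coord_field_transfer (2 ^ e) gK sKL' sL'M' sM'Lt nM').1 co.
  exists M'; split=> //; apply: coord_cyclic_HGS fu'; exact: galS.
move=> hs; have [M [nM cM noM]] := normal_without_coord e0 sHG fu cf cH hs.
(* As M is normal in G, its fixed field is normal over K and is its own normal closure. *)
pose L' : {subfield E} := [aspace of fixedField M].
have gL' : galois K L' := normal_fixedField_galois gK nM.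
have /and3P[sKL' _ nL'] := gL'.
have sL'Lt : (L' <= Lt)%VS := fixedField_bound M.
have galL' : 'Gal(Lt / L')%g = M := gal_fixedField M.
have dimL' : \dim_K L' = (2 ^ e)%N.
  rewrite -(galois_index gK sKL' sL'Lt) galL' -divgS ?normal_sub // cG cM.
  by rewrite mulKn ?expn_gt0.
exists L'; split; last split=> //; first by split; rewrite ?dimL.
case=> M' [ncM']; have ncL' : is_normal_closure K L' L' by split.
rewrite {M' ncM'}(normal_closure_uniq ncM' ncL') => HGS'.
have iL' : #|'Gal(L' / K) : 'Gal(L' / L')|%g = (2 ^ e)%N by rewrite galois_index.
have co := cyclic_HGS_coord (galS L' sKL') n1 iL' HGS'.
have [f' [u']] := (coord_field_transfer (2 ^ e) gK sKL' (subvv L') sL'Lt nL').2 co.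
by rewrite galL'; apply: noM.
Qed.
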